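(* Let $K\ge 2$ be an integer. The set of DC1 pairs $(x,y)\in\Sigma_K\times\Sigma_K$ for $\sigma_K$ has Hausdorff dimension $1$, and the set of DC2 pairs $(x,y)\in\Sigma_K\times\Sigma_K$ for $\sigma_K$ has Hausdorff dimension $1$.
   Context: $\Sigma_K=\{0,\dots,K-1\}^{\mathbb{N}}$ with $\mathbb{N}=\{0,1,2,\dots\}$, endowed with the metric $\rho(x,y)=K^{-\delta(x,y)}$, where $\delta(x,y)=\inf\{i\ge 0:x_i\ne y_i\}$ ($\rho(x,x)=0$). The shift map $\sigma_K:\Sigma_K\to\Sigma_K$ is $(\sigma_K(x))_i=x_{i+1}$. The product $\Sigma_K\times\Sigma_K$ carries the sup metric. For a continuous surjective self-map $f$ of a compact metric space $(X,\rho)$, for $x,y\in X$ and $\epsilon>0$, put $$F_{x,y}(\epsilon)=\liminf_{n\to\infty}\tfrac1n\#\{0\le i<n:\rho(f^i(x),f^i(y))<\epsilon\},\quad F^*_{x,y}(\epsilon)=\limsup_{n\to\infty}\tfrac1n\#\{0\le i<n:\rho(f^i(x),f^i(y))<\epsilon\}.$$ A pair $(x,y)\in X\times X$ is a DC1 pair if $F^*_{x,y}(\epsilon)=1$ for all $\epsilon>0$ and there is $\epsilon_0>0$ with $F_{x,y}(\epsilon)=0$ for all $\epsilon\in(0,\epsilon_0]$. It is a DC2 pair if $F^*_{x,y}(\epsilon)=1$ for all $\epsilon>0$ and there is $\epsilon_0>0$ with $F_{x,y}(\epsilon)<1$ for all $\epsilon\in(0,\epsilon_0]$. (The ''distributional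 chaos relation with respect to DC1 (DC2)'' is the set of DC1 (DC2) pairs.) *)

(* Defs.v *)
From HB Require Import structures.
From mathcomp Require Import all_boot all_order all_algebra.
From mathcomp Require Import all_classical all_reals all_analysis.

Set Implicit Arguments.
Unset Strict Implicit.
Unset Printing Implicit Defensive.

Import Order.TTheory GRing.Theory Num.Theory.
Import numFieldNormedType.Exports.

Local Open Scope classical_set_scope.
Local Open Scope ring_scope.

(* The topology of the library on products of pseudometric spaces has
   products of balls as balls, i.e. it comes from the sup metric. *)
Section product_metric.
Context {R : numFieldType} {X Y : metricType R}.

Definition prod_mdist (p q : X * Y) : R :=
  Num.max (mdist p.1 q.1) (mdist p.2 q.2).

Let mdist_cmp (p q : X * Y) : mdist p.1 q.1 >=< mdist p.2 q.2.
Proof. by apply: real_comparable; apply: ger0_real; exact: mdist_ge0. Qed.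

Let prod_mdist_ge0 p q : 0 <= prod_mdist p q.
Proof. by rewrite comparable_le_max ?mdist_ge0// mdist_cmp. Qed.

Let prod_mdist_positivity p q : prod_mdist p q = 0 -> p = q.
Proof.
move=> pq0; have : prod_mdist p q <= 0 by rewrite pq0.
rewrite comparable_ge_max ?mdist_cmp// => /andP[p0 q0].
by rewrite [p]surjective_pairing [q]surjective_pairing; congr pair;
  apply: mdist_positivity; apply/eqP; rewrite eq_le mdist_ge0 ?p0 ?q0.
Qed.

Let ballEprod_mdist p d : ball p d = [set q | prod_mdist p q < d].
Proof.
apply/seteqP; split => [q|q] /=; rewrite comparable_gt_max ?mdist_cmp//.
  by move=> [/=]; rewrite !ballEmdist /= => -> ->.
by move=> /andP[p1 p2]; split; rewrite ballEmdist.
Qed.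

HB.instance Definition _ := PseudoMetric_isMetric.Build R (X * Y)%type
  prod_mdist_ge0 prod_mdist_positivity ballEprod_mdist.

End product_metric.

(* The parameter R only records the field in which distances are taken. *)
Definition fullshift (R : realType) (K : nat) : Type := nat -> 'I_K.

Section fullshift_metric.
Context {R : realType} {K : nat}.
Implicit Types x y z : fullshift R K.

HB.instance Definition _ := Choice.copy (fullshift R K) (nat -> 'I_K).

(* K ^ - inf {i | x_i <> y_i}, with inf set0 = +oo and K ^ -oo = 0. *)
Definition rho x y : R :=
  match pselect (exists i, x i != y i) with
  | left xy => K%:R ^- ex_minn xy
  | right _ => 0
  end.

Lemma alphabet_ge1 x : 1 <= K%:R :> R.
Proof. by rewrite ler1n; exact: leq_ltn_trans (ltn_ord (x 0%N)). Qed.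

Lemma rho_ge x y n : x n != y n -> K%:R ^- n <= rho x y.
Proof.
move=> xyn; rewrite /rho; case: pselect => [xy|[]]; last by exists n.
case: ex_minnP => m _ /(_ _ xyn) mn; have K1 := alphabet_ge1 x.
rewrite lef_pV2 ?posrE ?exprn_gt0 ?(lt_le_trans ltr01)//.
exact: ler_weXn2l.
Qed.

Lemma rho_ge0 x y : 0 <= rho x y.
Proof.
by rewrite /rho; case: pselect => // ?; rewrite invr_ge0 exprn_ge0.
Qed.

Lemma rhoxx x : rho x x = 0.
Proof.
by rewrite /rho; case: pselect => // xx; exfalso; case: xx => i; rewrite eqxx.
Qed.

Lemma rho_positivity x y : rho x y = 0 -> x = y.
Proof.
move=> xy0; apply/funext => i; apply/eqP/negPn/negP => /rho_ge.
rewrite xy0 leNgt invr_gt0 exprn_gt0//.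
exact: lt_le_trans ltr01 (alphabet_ge1 x).
Qed.

Lemma rho_sym x y : rho x y = rho y x.
Proof.
rewrite /rho; case: pselect => [xy|xy]; case: pselect => [yx|yx] //.
- congr (_ ^- _); case: ex_minnP => m xm mP; case: ex_minnP => n xn nP.
  by apply/eqP; rewrite eqn_leq mP ?nP// eq_sym.
- by case: yx; case: xy => i; exists i; rewrite eq_sym.
- by case: xy; case: yx => i; exists i; rewrite eq_sym.
Qed.

Lemma rho_triangle y x z : rho x z <= rho x y + rho y z.
Proof.
rewrite {1}/rho; case: pselect => [xz|_]; last by rewrite addr_ge0 ?rho_ge0.
case: ex_minnP => n xzn _; have [xyn|xyn] := eqVneq (x n) (y n).
  by rewrite (le_trans (@rho_ge y z n _)) ?lerDr ?rho_ge0// -xyn.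
by rewrite (le_trans (rho_ge xyn)) ?lerDl ?rho_ge0.
Qed.

HB.instance Definition _ := isMetric.Build R (fullshift R K)
  rhoxx rho_positivity rho_sym rho_triangle.

Definition shift_map x : fullshift R K := fun i => x i.+1.

End fullshift_metric.
Arguments shift_map R K x : clear implicits.

Section distributional_chaos.
Context {R : realType} {X : metricType R}.
Variable f : X -> X.
Local Open Scope ereal_scope.

Definition close_freq (x y : X) (e : R) (n : nat) : \bar R :=
  (#|[pred i : 'I_n | mdist (iter i f x) (iter i f y) < e]|%:R / n%:R)%:E.

Definition lower_dist (x y : X) (e : R) := limn_einf (close_freq x y e).

Definition upper_dist (x y : X) (e : R) := limn_esup (close_freq x y e).

Definition DC1_pairs : set (X * X) := [set xy |
  (forall e : R, (0 < e)%R -> upper_dist xy.1 xy.2 e = 1) /\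
  exists2 e0 : R, (0 < e0)%R &
    forall e : R, (0 < e <= e0)%R -> lower_dist xy.1 xy.2 e = 0].

Definition DC2_pairs : set (X * X) := [set xy |
  (forall e : R, (0 < e)%R -> upper_dist xy.1 xy.2 e = 1) /\
  exists2 e0 : R, (0 < e0)%R &
    forall e : R, (0 < e <= e0)%R -> lower_dist xy.1 xy.2 e < 1].

End distributional_chaos.

Section hausdorff_dimension.
Context {R : realType} {X : metricType R}.
Implicit Types (A U : set X) (s d : R).
Local Open Scope ereal_scope.

(* The maximum with 0 makes the diameter of the empty set 0. *)
Definition diam U : \bar R :=
  maxe 0 (ereal_sup [set (mdist p.1 p.2)%:E | p in U `*` U]).

(* poweR 0 0 = 1, so points have weight 1 when s = 0; the empty set has
   weight 0 for all s, hence finite covers are sequences padded with set0. *)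
Definition diam_weight s U : \bar R :=
  if U == set0 then 0 else poweR (diam U) s.

Definition hausdorff_premeasure s d A : \bar R :=
  ereal_inf [set \sum_(0 <= i <oo) diam_weight s (U i) | U in
    [set U : (set X)^nat |
      A `<=` \bigcup_i U i /\ forall i, diam (U i) <= d%:E]].

Definition hausdorff_measure s A : \bar R :=
  ereal_sup [set hausdorff_premeasure s d A | d in [set d : R | (0 < d)%R]].

Definition hausdorff_dim A : \bar R :=
  ereal_inf [set s%:E | s in
    [set s : R | (0 <= s)%R /\ hausdorff_measure s A = 0]].

End hausdorff_dimension.

(* Main.v *)
(* Upper bound: distributional proximality already forces, for any eta > 0,
   infinitely many n for which the first n letters of x and y differ at fewer
   than eta * n positions.  There are only K^(n(1 + o(1))) such pairs of words
   as eta -> 0, so covering by the corresponding cylinders gives dimension at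
   most 1.
   Lower bound: let y = phi x agree with x on the blocks
   [2^2^k, 2^2^(k+1)) with k even and differ from it everywhere on those with k
   odd.  As the block lengths grow superexponentially, (x, phi x) is a DC1 pair
   for every x, and the graph of phi projects onto the whole shift, which has
   dimension 1 by comparison with Lebesgue measure through base K expansions. *)
Require Import Defs.
From mathcomp Require Import all_boot all_order all_algebra.
From mathcomp Require Import all_classical all_reals all_analysis.
From mathcomp Require Import ring lra zify.

Set Implicit Arguments.
Unset Strict Implicit.
Unset Printing Implicit Defensive.

Import Order.TTheory GRing.Theory Num.Theory.

Local Open Scope classical_set_scope.
Local Open Scope ring_scope.

(** * Agreement of letters and the metric of the full shift *)

Lemma rho_le (R : realType) (K : nat) (x y : fullshift R K) (n : nat) :
  (forall i, (i < n)%N -> x i = y i) -> rho x y <= K%:R ^- n.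
Proof.
move=> xyn; have K1 := alphabet_ge1 x.
have K0 : 0 < K%:R :> R := lt_le_trans ltr01 K1.
rewrite /rho; case: pselect => [xy|_]; last by rewrite invr_ge0 exprn_ge0.
case: ex_minnP => m xym _; rewrite lef_pV2 ?posrE ?exprn_gt0//.
apply: ler_weXn2l => //; rewrite leqNgt; apply/negP => /xyn xyE.
by rewrite xyE eqxx in xym.
Qed.

Lemma rho_lt_agree (R : realType) (K : nat) (x y : fullshift R K) (n : nat) :
  rho x y < K%:R ^- n -> x n = y n.
Proof. by move=> xy; apply/eqP/negPn/negP => /rho_ge; rewrite leNgt xy. Qed.

Lemma iter_shift (R : realType) (K : nat) (x : fullshift R K) (i j : nat) :
  iter i (shift_map R K) x j = x (i + j)%N.
Proof. by elim: i j => [//|i IH] j; rewrite iterS /shift_map IH addnS. Qed.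

Lemma fullshift_mdistE (R : realType) (K : nat) (x y : fullshift R K) :
  mdist x y = rho x y.
Proof. by []. Qed.

Lemma prod_mdistE (R : realType) (X Y : metricType R) (p q : X * Y) :
  mdist p q = Num.max (mdist p.1 q.1) (mdist p.2 q.2).
Proof. by []. Qed.

(** * Diameters, weights of covers and Hausdorff dimension *)

Section hausdorff_dim.
Context {R : realType} {X : metricType R}.
Implicit Types (A B U : set X) (s d : R).
Local Open Scope ereal_scope.

Lemma mdist_le_diam U p q : U p -> U q -> (mdist p q)%:E <= diam U.
Proof.
move=> Up Uq; rewrite /diam le_max; apply/orP; right.
by apply: ereal_sup_ubound; exists (p, q).
Qed.

Lemma diam_le U d : (0 <= d)%R ->
  (forall p q, U p -> U q -> (mdist p q <= d)%R) -> diam U <= d%:E.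
Proof.
move=> d0 Ud; rewrite /diam ge_max lee_fin d0/=.
by apply: ge_ereal_sup => _ [[p q] [/= Up Uq] <-]; rewrite lee_fin Ud.
Qed.

Lemma diam_ge0 U : 0 <= diam U.
Proof. by rewrite /diam le_max lexx. Qed.

Lemma diam_weight_ge0 s U : 0 <= diam_weight s U.
Proof. by rewrite /diam_weight; case: ifP => // _; exact: poweR_ge0. Qed.

Lemma diam_weight_le s U d : (0 <= s)%R -> (0 <= d)%R -> diam U <= d%:E ->
  diam_weight s U <= (d `^ s)%:E.
Proof.
move=> s0 d0 Ud; rewrite /diam_weight; case: ifPn => _.
  by rewrite lee_fin powR_ge0.
rewrite -poweR_EFin; apply: gt0_ler_poweR => //.
- by rewrite in_itv/= diam_ge0 leey.
- by rewrite in_itv/= lee_fin d0 leey.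
Qed.

(** On [0,1] one has u <= u^s for s <= 1, so a small weight sum bounds the total diameter. *)
Lemma diam_le_weight s U : (s <= 1)%R -> U !=set0 -> diam U <= 1 ->
  diam U <= diam_weight s U.
Proof.
move=> s1 U0 U1; rewrite /diam_weight ifF; last by apply/negbTE/set0P.
have Ufin : diam U \is a fin_num.
  by rewrite ge0_fin_numE ?diam_ge0// (le_lt_trans U1) ?ltry.
rewrite -(fineK Ufin) poweR_EFin.
have := diam_ge0 U; rewrite le_eqVlt => /predU1P[<-|].
  by rewrite lee_fin powR_ge0.
rewrite -{1}(fineK Ufin) lte_fin lee_fin => u0.
by apply: ger1_powR => //; rewrite u0 -lee_fin fineK.
Qed.

Lemma hausdorff_premeasure_ge0 s d A : 0 <= hausdorff_premeasure s d A.
Proof.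
apply: le_ereal_inf_tmp => _ [U _ <-]; apply: nneseries_ge0 => n _ _.
exact: diam_weight_ge0.
Qed.

Lemma hausdorff_measure0_cover s A (e : R) : hausdorff_measure s A = 0 ->
  (0 < e)%R -> exists U : (set X)^nat,
    [/\ A `<=` \bigcup_i U i, forall i, diam (U i) <= 1 &
        \sum_(0 <= i <oo) diam_weight s (U i) < e%:E].
Proof.
move=> HA0 e0.
have : hausdorff_premeasure s 1 A < e%:E.
  apply: le_lt_trans (_ : 0 < e%:E); last by rewrite lte_fin.
  by rewrite -HA0; apply: ereal_sup_ubound; exists 1%R => //=.
by move=> /ereal_inf_lt[_ [U [AU Ud] <-] Ue]; exists U.
Qed.

(** Indices outside the image of [pickle] receive the empty set, whose weight is 0. This allows
    covers indexed by words of all lengths. *)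
Lemma hausdorff_premeasure_le (T : countType) s d A (U : T -> set X) :
  (0 <= d)%R -> A `<=` \bigcup_t U t -> (forall t, diam (U t) <= d%:E) ->
  hausdorff_premeasure s d A <= \esum_(t in [set: T]) diam_weight s (U t).
Proof.
move=> d0 AU Ud.
pose V k := if @pickle_inv T k is Some t then U t else set0.
have VP t : V (pickle t) = U t by rewrite /V pickleK_inv.
apply: le_trans (_ : \sum_(0 <= i <oo) diam_weight s (V i) <= _).
  apply: ereal_inf_lbound; exists V => //=; split.
    by move=> x /AU[t _ Utx]; exists (pickle t) => //; rewrite VP.
  move=> i; rewrite /V; case: pickle_inv => // .
  by apply: diam_le => // p q [].
rewrite nneseries_esumT; last by move=> n; exact: diam_weight_ge0.
rewrite [leLHS](_ : _ = \esum_(i in pickle @` [set: T]) diam_weight s (V i)).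
  rewrite esum_image; last by move=> t u _ _; exact: (pcan_inj pickleK).
  by apply: le_esum => t _; rewrite VP.
rewrite [RHS]esum_mkcond; apply: eq_esum => i _; case: ifPn => // /negP iV.
rewrite /V; case E : pickle_inv => [t|]; last by rewrite /diam_weight eqxx.
exfalso; apply: iV; rewrite inE; exists t => //.
by have := @pickle_invK T i; rewrite E.
Qed.

Lemma hausdorff_dim_le1 A :
  (forall s, (1 < s)%R -> forall d, (0 < d)%R ->
     hausdorff_premeasure s d A = 0) -> hausdorff_dim A <= 1.
Proof.
move=> HA; apply/lee_addgt0Pr => e e0; apply: ereal_inf_lbound.
exists (1 + e)%R => //=; split; first by lra.
rewrite /hausdorff_measure; apply/eqP; rewrite eq_le; apply/andP; split.
  by apply: ge_ereal_sup => _ [d /= d0 <-]; rewrite HA//; lra.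
apply: le_trans (hausdorff_premeasure_ge0 (1 + e) 1 A) _.
by apply: ereal_sup_ubound; exists 1%R => //=.
Qed.

End hausdorff_dim.

(** * Base K expansions of real numbers in [0,1) *)

Lemma near_expr_lt (R : realType) (r e : R) : 0 <= r < 1 -> 0 < e ->
  \forall n \near \oo, r ^+ n < e.
Proof.
move=> /andP[r0 r1] e0; have r1' : `|r| < 1 by rewrite ger0_norm.
have /cvgrPdist_lt/(_ e e0) := cvg_geometric 1 r1'.
by apply: filterS => n; rewrite /= mul1r sub0r normrN ger0_norm ?exprn_ge0.
Qed.

Lemma exists_expVn_lt (R : realType) (K : nat) (e : R) : (1 < K)%N -> 0 < e ->
  exists n, K%:R ^- n < e.
Proof.
move=> K1 e0; have Kinv1 : 0 <= (K%:R^-1 : R) < 1.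
  by rewrite invr_ge0 ler0n invf_lt1 ?ltr1n ?ltr0n// ltnW.
have [n] := filter_ex (near_expr_lt Kinv1 e0).
by exists n; rewrite -exprVn.
Qed.

Section base_expansion.
Context {R : realType} {K : nat} (K_gt1 : (1 < K)%N).
Implicit Types t u : R.

Definition digits t : fullshift R K :=
  fun i => Ordinal (ltn_pmod (Num.truncn (K%:R ^+ i.+1 * t)) (ltnW K_gt1)).

Lemma truncn_divn t : 0 <= t -> (Num.truncn (K%:R * t) %/ K)%N = Num.truncn t.
Proof.
move=> t0; have K0 : 0 < K%:R :> R by rewrite ltr0n ltnW.
have Kt0 : 0 <= K%:R * t by rewrite mulr_ge0 // ltW.
apply/esym/eqP; rewrite truncn_eq//; have /andP[] := truncn_itv Kt0.
set m := Num.truncn _ => mt tm; apply/andP; split.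
  rewrite -(ler_pM2l K0); apply: le_trans mt.
  by rewrite -natrM ler_nat mulnC leq_trunc_div.
rewrite -(ltr_pM2l K0); apply: lt_le_trans tm _.
by rewrite -natrM ler_nat mulnC ltn_ceil// ltnW.
Qed.

(** Induction on n: the integer part of K^(n+1) t is determined by that of K^n t and by digit n of
    t. *)
Lemma digits_truncn t u n : 0 <= t < 1 -> 0 <= u < 1 ->
  (forall i, (i < n)%N -> digits t i = digits u i) ->
  Num.truncn (K%:R ^+ n * t) = Num.truncn (K%:R ^+ n * u).
Proof.
move=> /andP[t0 t1] /andP[u0 u1]; elim: n => [|n IH] tu.
  rewrite !expr0 !mul1r; transitivity 0%N; [|symmetry];
    by apply/eqP; rewrite truncn_eq ?mulr0n ?mulr1n//; apply/andP.
have Kn0 v : 0 <= v -> 0 <= K%:R ^+ n * v.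
  by move=> ?; rewrite mulr_ge0 ?exprn_ge0.
have /(congr1 val)/= mod_tu := tu _ (ltnSn n).
rewrite (divn_eq (Num.truncn (K%:R ^+ n.+1 * t)) K) mod_tu.
rewrite [RHS](divn_eq _ K) !exprS -!mulrA !truncn_divn ?Kn0//.
by rewrite IH// => i /ltnW/tu.
Qed.

(** After scaling by K^n, both numbers lie in the same interval [m, m+1). *)
Lemma dist_lt_digits t u n : 0 <= t < 1 -> 0 <= u < 1 ->
  (forall i, (i < n)%N -> digits t i = digits u i) ->
  `|t - u| < K%:R ^- n.
Proof.
move=> t01 u01 /(digits_truncn t01 u01) tu.
have Kn : 0 < K%:R ^+ n :> R by rewrite exprn_gt0 ?ltr0n 1?ltnW.
have /andP[t1 t2] : (Num.truncn (K%:R ^+ n * t))%:R <= K%:R ^+ n * t <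
    (Num.truncn (K%:R ^+ n * t)).+1%:R.
  by apply: truncn_itv; rewrite mulr_ge0 ?(ltW Kn)//; case/andP: t01.
have /andP[u1 u2] : (Num.truncn (K%:R ^+ n * u))%:R <= K%:R ^+ n * u <
    (Num.truncn (K%:R ^+ n * u)).+1%:R.
  by apply: truncn_itv; rewrite mulr_ge0 ?(ltW Kn)//; case/andP: u01.
rewrite -tu -!natr1 in t2 u1 u2.
rewrite -(ltr_pM2l Kn) divff ?gt_eqF// -{1}(gtr0_norm Kn) -normrM.
rewrite ltr_norml mulrBr.
by apply/andP; split; lra.
Qed.

(** The first differing digit bounds the distance; if there is none, the distance is below every
    K^-n. Recovering a real from its digits is thus 1-Lipschitz. *)
Lemma dist_le_rho_digits t u : 0 <= t < 1 -> 0 <= u < 1 ->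
  `|t - u| <= rho (digits t) (digits u).
Proof.
move=> t01 u01; rewrite /rho; case: pselect => [tu|tu].
  case: ex_minnP => n _ nP; apply/ltW/dist_lt_digits => // i.
  by rewrite ltnNge; apply: contraNeq => /nP.
rewrite leNgt; apply/negP => /(exists_expVn_lt K_gt1)[n]; apply/negP.
rewrite -leNgt ltW// dist_lt_digits// => i _.
by apply/eqP/negPn/negP => iP; apply: tu; exists i.
Qed.

End base_expansion.

(** * Lower bound for sets containing a graph *)

(** Suppose the s-dimensional measure vanishes for some s < 1. A cover of weight below 1/2 induces
    intervals of length at most twice the diameters, hence twice the weights. They cover [0,1) with
    total length below 1, against its Lebesgue measure. *)
Lemma hausdorff_dim_graph_ge1 (R : realType) (K : nat)
    (phi : fullshift R K -> fullshift R K)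
    (A : set (fullshift R K * fullshift R K)) :
  (1 < K)%N -> (forall x, A (x, phi x)) -> (1 <= hausdorff_dim A)%E.
Proof.
move=> K1 Aphi; apply: le_ereal_inf_tmp => _ [s [/= s0 HA0] <-].
rewrite lee_fin leNgt; apply/negP => s1.
have half_gt0 : 0 < 2^-1 :> R by lra.
have [U [AU U1 Usum]] := hausdorff_measure0_cover HA0 half_gt0.
pose D (t : R) := (digits K1 t, phi (digits K1 t)).
pose T i := [set t : R | 0 <= t < 1 /\ U i (D t)].
(* A centre chosen in [T i]; when [T i] is empty the default 0 is harmless, as [I i] is then
   empty. *)
pose c i : R := xget 0 (T i).
pose r i : R := fine (diam (U i)).
have rE i : (r i)%:E = diam (U i).
  by rewrite fineK// ge0_fin_numE ?diam_ge0// (le_lt_trans (U1 i)) ?ltry.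
have r0 i : 0 <= r i by rewrite -lee_fin rE diam_ge0.
pose I i : set R :=
  if T i == set0 then set0 else `[c i - r i, c i + r i]%classic.
have TI i : T i `<=` I i.
  move=> t Tt; rewrite /I ifF; last by apply/eqP => T0; rewrite T0 in Tt.
  have [c01 Uc] : T i (c i) by apply: (@xgetPex _ 0); exists t.
  case: Tt => t01 Ut; have := mdist_le_diam Uc Ut.
  (* The sup metric dominates the distance between the first coordinates, which are the digit
     sequences. *)
  rewrite -rE lee_fin prod_mdistE /= ge_max => /andP[+ _].
  rewrite fullshift_mdistE => /(le_trans (dist_le_rho_digits K1 c01 t01)).
  by rewrite ler_norml in_itv/= => /andP[? ?]; apply/andP; split; lra.
have mI i : measurable (I i) by rewrite /I; case: ifP.
have cover : `[0, 1[%classic `<=` \bigcup_i I i.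
  move=> t; rewrite /= in_itv/= => t01.
  have [i _ Ui] := AU _ (Aphi (digits K1 t)).
  by exists i => //; apply: TI.
have : (lebesgue_measure `[0%R : R, 1%R[%classic <=
    \sum_(0 <= i <oo) lebesgue_measure (I i))%E.
  by apply: (measure_sigma_subadditive lebesgue_measure) => //=.
rewrite lebesgue_measure_itv/= lte_fin ltr01 oppr0 adde0 leNgt => /negP; apply.
apply: le_lt_trans (_ : \sum_(0 <= i <oo) (2%:E * diam_weight s (U i)) < 1)%E.
  apply: lee_nneseries => [i _ _|i _]; first exact: measure_ge0.
  rewrite /I; case: ifPn => [_|/set0P[t [_ Ut]]].
    by rewrite measure0 mule_ge0 ?lee_fin// diam_weight_ge0.
  rewrite lebesgue_measure_itv/=.
  apply: le_trans (_ : (2%:E * diam (U i)) <= _)%E; last first.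
    rewrite lee_wpmul2l// ?lee_fin//.
    by apply: diam_le_weight; [exact: ltW | exists (D t) | exact: U1].
  rewrite -rE -EFinM; case: ifPn => _.
    by rewrite -EFinB lee_fin; lra.
  by rewrite lee_fin mulr_ge0.
rewrite nneseriesZl; last by move=> i _; exact: diam_weight_ge0.
apply: lt_le_trans (_ : 2%:E * 2^-1%:E <= _)%E.
  by rewrite lte_pmul2l// lte_fin.
by rewrite -EFinM lee_fin divff.
Qed.

(** * Upper and lower limits of the frequency of close times *)

Lemma limn_esup_frequently (R : realType) (u : (\bar R)^nat) (l : \bar R)
    (N : nat) :
  (l < limn_esup u)%E -> exists2 n, (N <= n)%N & (l < u n)%E.
Proof.
move=> lu; have : (l < ereal_sup [set u n | n in [set n | (N <= n)%N]])%E.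
  apply: lt_le_trans lu _; apply: ereal_inf_lbound.
  by exists [set n | (N <= n)%N] => //; exact: nbhs_infty_ge.
by move=> /ereal_sup_gt[_ [n /= Nn <-] lun]; exists n.
Qed.

(** The upper limit is an infimum of suprema over the sets of the filter. The whole set gives the
    upper bound; each set contains a tail, where u comes close to l. *)
Lemma limn_esup_max (R : realType) (u : (\bar R)^nat) (l : R) :
  (forall n, u n <= l%:E)%E ->
  (forall e N, 0 < e -> exists2 n, (N <= n)%N & ((l - e)%:E <= u n)%E) ->
  limn_esup u = l%:E.
Proof.
move=> ul lu; apply/eqP; rewrite eq_le; apply/andP; split.
  apply: le_trans (_ : ereal_sup (range u) <= _)%E.
    by apply: ereal_inf_lbound; exists setT => //; exact: filterT.
  by apply: ge_ereal_sup => _ [n _ <-].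
apply: le_ereal_inf_tmp => _ [V [N _ NV] <-].
apply/lee_addgt0Pr => e e0; have [n Nn un] := lu e N e0.
rewrite -leeBlDr// -EFinB; apply: le_trans un _.
by apply: ereal_sup_ubound; exists n => //; exact: NV.
Qed.

Lemma card_ord_pred (n : nat) (P : pred nat) :
  #|[pred i : 'I_n | P i]| = (\sum_(0 <= i < n) P i)%N.
Proof. by rewrite -sum1_card big_mkcond /= big_mkord. Qed.

Lemma card_ord_pred_ge (n a b : nat) (P : pred nat) : (a <= b <= n)%N ->
  (forall i, (a <= i < b)%N -> P i) -> (b - a <= #|[pred i : 'I_n | P i]|)%N.
Proof.
move=> /andP[ab bn] abP; rewrite card_ord_pred.
rewrite (big_cat_nat (n := a))//=; last exact: leq_trans bn.
rewrite (big_cat_nat (n := b) (m := a))//=.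
apply: leq_trans (leq_addl _ _); apply: leq_trans (leq_addr _ _).
rewrite -[leqLHS]muln1 -sum_nat_const_nat big_nat_cond [leqRHS]big_nat_cond.
by apply: leq_sum => i; rewrite andbT => /abP ->.
Qed.

Section close_freq.
Context {R : realType} {X : metricType R} (f : X -> X).
Implicit Types (x y : X) (e : R).

Lemma close_freq_ge0 x y e n : (0 <= close_freq f x y e n)%E.
Proof. by rewrite lee_fin divr_ge0. Qed.

Lemma close_freq_le1 x y e n : (close_freq f x y e n <= 1)%E.
Proof.
(* Division by 0 gives 0, which settles n = 0. *)
rewrite lee_fin; case: n => [|n]; first by rewrite invr0 mulr0.
rewrite ler_pdivrMr ?ltr0n// mul1r ler_nat.
by rewrite -[leqRHS]card_ord max_card.
Qed.

Lemma close_freq_ge x y e n a b : (a <= b <= n)%N ->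
  (forall i, (a <= i < b)%N -> mdist (iter i f x) (iter i f y) < e) ->
  (((b - a)%:R / n%:R)%:E <= close_freq f x y e n)%E.
Proof.
move=> abn close_ab; rewrite lee_fin ler_wpM2r ?invr_ge0// ler_nat.
exact: (card_ord_pred_ge (P := fun i => mdist (iter i f x) (iter i f y) < e)).
Qed.

(** At least n - a of the n times are far; the close ones are counted as the complement. *)
Lemma close_freq_le x y e n a : (a <= n)%N ->
  (forall i, (a <= i < n)%N -> e <= mdist (iter i f x) (iter i f y)) ->
  (close_freq f x y e n <= (a%:R / n%:R)%:E)%E.
Proof.
move=> an far_an; rewrite lee_fin ler_wpM2r ?invr_ge0// ler_nat.
have := card_ord_pred_ge (n := n) (a := a) (b := n)
  (P := fun i => ~~ (mdist (iter i f x) (iter i f y) < e)).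
rewrite an leqnn => /(_ isT) far.
pose A := [pred i : 'I_n | mdist (iter i f x) (iter i f y) < e].
have {}far : (n - a <= #|[predC A]|)%N.
  by apply: far => i; rewrite -leNgt => /far_an.
have := cardC A; rewrite card_ord => AC.
by rewrite -(leq_add2r #|[predC A]|) AC -leq_subLR.
Qed.

Lemma upper_dist_eq1 x y e :
  (forall d N, 0 < d -> exists2 n, (N <= n)%N &
     ((1 - d)%:E <= close_freq f x y e n)%E) ->
  upper_dist f x y e = 1%E.
Proof. by apply: limn_esup_max => n; exact: close_freq_le1. Qed.

Lemma lower_dist_eq0 x y e :
  (forall d N, 0 < d -> exists2 n, (N <= n)%N &
     (close_freq f x y e n <= d%:E)%E) ->
  lower_dist f x y e = 0%E.
Proof.
(* The lower limit is minus the upper limit of the opposite sequence, which is bounded by 0. *)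
move=> small; rewrite /lower_dist /limn_einf (@limn_esup_max _ _ 0) ?oppe0//.
  by move=> n; rewrite leeNl oppe0 close_freq_ge0.
move=> d N /small -/(_ N)[n Nn ud]; exists n => //.
by rewrite sub0r EFinN leeN2.
Qed.

Lemma DC1_sub_DC2 : DC1_pairs f `<=` DC2_pairs f.
Proof.
move=> xy [up [e0 e0_gt0 low]]; split => //.
by exists e0 => // e /low ->; rewrite lte_fin.
Qed.

End close_freq.

(** * Doubly exponential blocks and a DC1 partner for every point *)

(** Two logarithms recover k on the block [2^2^k, 2^2^(k+1)). The indices 0 and 1, which precede all
    blocks, count as even since [trunc_log 2 0 = 0]. *)
Definition odd_block (i : nat) : bool := odd (trunc_log 2 (trunc_log 2 i)).

Lemma odd_blockE (k i : nat) : (2 ^ 2 ^ k <= i < 2 ^ 2 ^ k.+1)%N ->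
  odd_block i = odd k.
Proof.
move=> /andP[ki ik]; rewrite /odd_block (@trunc_log_eq 2 k)//.
rewrite trunc_log_max//= -(@ltn_exp2l 2)//; apply: leq_ltn_trans ik.
by apply: trunc_logP => //; apply: leq_trans ki; rewrite expn_gt0.
Qed.

Lemma ltn_block (k : nat) : (k < 2 ^ 2 ^ k)%N.
Proof. by apply: ltn_trans (ltn_expl _ _) (ltn_expl _ _). Qed.

Lemma blockS (k : nat) : (2 ^ 2 ^ k.+1 = 2 ^ 2 ^ k * 2 ^ 2 ^ k)%N.
Proof. by rewrite expnS mul2n -addnn expnD. Qed.

Definition flip_odd_blocks (R : realType) (K : nat) (x : fullshift R K) :
  fullshift R K := fun i => if odd_block i then ordS (x i) else x i.

Lemma ordS_neq (K : nat) (a : 'I_K) : (1 < K)%N -> ordS a != a.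
Proof.
move=> K1; apply/eqP => /(congr1 val)/=.
have := ltn_ord a; rewrite leq_eqVlt => /predU1P[aK|aK].
  by rewrite aK modnn; lia.
by rewrite modn_small//; lia.
Qed.

(** With M = 2^2^k, block k is [M, M^2) and misses only a proportion 1/M of the indices below M^2.
    At n = M^2 the frequency is therefore near 1 for even k and near 0 for odd k. *)
Lemma flip_odd_blocks_DC1 (R : realType) (K : nat) (x : fullshift R K) :
  (1 < K)%N -> DC1_pairs (shift_map R K) (x, flip_odd_blocks x).
Proof.
move=> K1; split => [e e0|]; last (exists 1 => // e /andP[e0 e1]) => /=.
- have [m me] := exists_expVn_lt K1 e0.
  apply: upper_dist_eq1 => d N d0.
  (* Doubling makes k even, and M > k then dominates N, m and (m + 1) / d. *)
  pose k := (maxn (maxn N m.+1) (Num.bound (m.+1%:R / d))).*2.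
  set M := (2 ^ 2 ^ k)%N; have kM : (k < M)%N := ltn_block k.
  have [Nk mk dk] : [/\ N <= k, m < k & Num.bound (m.+1%:R / d) <= k]%N.
    by split; lia.
  have mM : m.+1%:R <= d * M%:R.
    rewrite mulrC -ler_pdivrMr//; apply/ltW.
    apply: lt_le_trans (archi_boundP _) _; first by rewrite divr_ge0// ltW.
    by rewrite ler_nat (leq_trans dk) // ltnW.
  exists (M * M)%N; first nia.
  (* The last m times of the block are dropped so that the window of m letters stays inside it. *)
  apply: le_trans (close_freq_ge (a := M) (b := M * M - m) _ _); first last.
  + move=> i iM; rewrite fullshift_mdistE; apply: le_lt_trans me.
    apply: rho_le => j jm; rewrite !iter_shift /flip_odd_blocks.
    rewrite /= (@odd_blockE k) ?odd_double//; apply/andP.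
    rewrite -/M blockS -/M.
    by split; lia.
  + by nia.
  + have M0 : 0 < M%:R :> R by rewrite ltr0n; lia.
    rewrite lee_fin ler_pdivlMr ?natrM ?mulr_gt0// !natrB ?natrM; try nia.
    have {}mM : m.+1%:R * M%:R <= d * M%:R * M%:R by rewrite ler_pM2r.
    (* The loss satisfies m + M <= (m + 1) M <= d M^2. *)
    have : (m + M)%:R <= (m.+1 * M)%:R :> R by rewrite ler_nat; nia.
    rewrite natrD natrM; lra.
- apply: lower_dist_eq0 => d N d0.
  (* Here k is odd: at most M of the M^2 times are close, and 1 / M <= d. *)
  pose k := (maxn N (Num.bound d^-1)).*2.+1.
  set M := (2 ^ 2 ^ k)%N; have kM : (k < M)%N := ltn_block k.
  have [Nk dk] : (N <= k /\ Num.bound d^-1 <= k)%N by split; lia.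
  exists (M * M)%N; first by nia.
  apply: le_trans (close_freq_le (a := M) _ _) _; first by nia.
    move=> i iM; rewrite fullshift_mdistE; apply: le_trans e1 _.
    (* The first letters differ, so the distance is at least K^0 = 1. *)
    rewrite -[1]invr1 -(expr0 K%:R); apply: rho_ge.
    rewrite !iter_shift addn0 /flip_odd_blocks /= (@odd_blockE k).
      by rewrite /= odd_double eq_sym ordS_neq.
    by rewrite blockS.
  have M0 : 0 < M%:R :> R by rewrite ltr0n; lia.
  rewrite lee_fin natrM invfM mulrA divff ?gt_eqF// mul1r invf_ple ?posrE//.
  apply/ltW/(lt_le_trans (archi_boundP _)); first by rewrite invr_ge0 ltW.
  by rewrite ler_nat (leq_trans dk)// ltnW.
Qed.

(** * Sums over words grouped by length, and geometric tails *)

Lemma esum_finType (R : realType) (T : finType) (a : T -> \bar R) :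
  (forall t, 0 <= a t)%E ->
  \esum_(t in [set: T]) a t = \sum_t a t.
Proof.
move=> a0; rewrite esum_fset//; last exact: finite_finset.
rewrite (fsbigE (enum T)) ?enum_uniq//; last by move=> t _; rewrite mem_enum.
by under eq_bigl do rewrite in_setT; rewrite big_enum.
Qed.

Lemma esum_tagged_fin (R : realType) (T_ : nat -> finType)
    (a : {n : nat & T_ n} -> \bar R) : (forall t, 0 <= a t)%E ->
  (\esum_(t in [set: {n : nat & T_ n}]) a t =
   \sum_(0 <= n <oo) \sum_(w : T_ n) a (Tagged T_ w))%E.
Proof.
move=> a0; pose J n := [set Tagged T_ w | w in [set: T_ n]].
have -> : [set: {n : nat & T_ n}] = \bigcup_n J n.
  by apply/seteqP; split => // -[n w] _; exists n => //; exists w.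
rewrite nneseries_sum_bigcup//; last first.
  by move=> n m _ _ [_ [[w _ <-] [v _ /(congr1 (@tag _ _))]]].
apply: eq_eseriesr => n _.
rewrite esum_image ?esum_finType// => w v _ _ /eqP.
by rewrite eq_Tagged => /eqP.
Qed.

Lemma nneseries_geometric_tail_le (R : realType) (c : R) (N : nat) :
  0 <= c < 1 ->
  (\sum_(0 <= n <oo) (if (N <= n)%N then c ^+ n else 0)%:E
     <= (c ^+ N / (1 - c))%:E)%E.
Proof.
move=> /andP[c0 c1]; pose u n := if (N <= n)%N then c ^+ n else 0.
have u0 n : 0 <= u n by rewrite /u; case: ifP => // _; exact: exprn_ge0.
apply: lime_le; first by apply: is_cvg_nneseries => n _ _; rewrite lee_fin u0.
apply: nearW => m; rewrite sumEFin lee_fin ler_pdivlMr ?subr_gt0//.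
(* This sharper bound telescopes; while m <= N the maximum makes both sides 0. *)
suff: (\sum_(0 <= n < m) u n) * (1 - c) <= c ^+ N - c ^+ (maxn N m).
  by move=> /le_trans; apply; rewrite gerBl exprn_ge0.
elim: m => [|m IH]; first by rewrite big_nil mul0r maxn0 subrr.
rewrite big_nat_recr//= mulrDl {2}/u; case: leqP => [Nm|mN].
  move: IH; rewrite !(maxn_idPr _) ?(leqW Nm)// exprS; lra.
rewrite mul0r addr0 (le_trans IH)// (maxn_idPl (ltnW mN)).
by rewrite (maxn_idPl mN).
Qed.

(** * Generating function of the number of mismatches *)

Section mismatch.
Context {R : realType} {K : nat}.
Implicit Types (z : R) (x y : nat -> 'I_K).

Definition mismatch_weight z (a : 'I_K * 'I_K) : R :=
  if a.1 != a.2 then z else 1.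

Lemma mismatch_weight_ge0 z a : 0 <= z -> 0 <= mismatch_weight z a.
Proof. by rewrite /mismatch_weight; case: ifP. Qed.

(** There are K diagonal pairs of weight 1 and K (K - 1) other pairs of weight z. *)
Lemma sum_mismatch_weight z :
  \sum_a mismatch_weight z a = K%:R * (K%:R * z + (1 - z)).
Proof.
rewrite -(pair_bigA _ (fun i j => mismatch_weight z (i, j)))/=.
transitivity (\sum_(i < K) (K%:R * z + (1 - z))); last first.
  by rewrite sumr_const card_ord [RHS]mulr_natl.
apply: eq_bigr => i _; rewrite (bigD1 i)//= /mismatch_weight eqxx/=.
rewrite (eq_bigr (fun=> z)); last by move=> j ji; rewrite eq_sym ji.
have -> : K%:R * z = \sum_(j < K) z.
  by rewrite sumr_const card_ord [LHS]mulr_natl.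
rewrite [in RHS](bigD1 i)//=; lra.
Qed.

(** Positions are chosen independently, so distributivity turns the sum over word pairs into a
    power. *)
Lemma sum_prod_mismatch_weight z n :
  \sum_(w : {ffun 'I_n -> 'I_K * 'I_K}) \prod_i mismatch_weight z (w i) =
  (K%:R * (K%:R * z + (1 - z))) ^+ n.
Proof.
rewrite -(bigA_distr_bigA (fun _ => mismatch_weight z)).
by rewrite prodr_const card_ord sum_mismatch_weight.
Qed.

Lemma prod_mismatch_weight z x y n :
  \prod_(i < n) mismatch_weight z (x i, y i) =
  z ^+ #|[pred i : 'I_n | x i != y i]|.
Proof. by rewrite -prodr_const -big_mkcond. Qed.

End mismatch.

(** * Covers by cylinders over word pairs with few mismatches *)

Definition pair_cylinder (R : realType) (K n : nat)
    (w : {ffun 'I_n -> 'I_K * 'I_K}) : set (fullshift R K * fullshift R K) :=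
  [set xy : fullshift R K * fullshift R K |
     forall i : 'I_n, (xy.1 i, xy.2 i) = w i].

Lemma diam_pair_cylinder (R : realType) (K n : nat)
    (w : {ffun 'I_n -> 'I_K * 'I_K}) :
  (diam (pair_cylinder (R := R) w) <= (K%:R ^- n)%:E)%E.
Proof.
apply: diam_le => [|p q pw qw]; first by rewrite invr_ge0 exprn_ge0.
rewrite prod_mdistE ge_max; apply/andP; split; apply: rho_le => i iln;
  by have := qw (Ordinal iln); rewrite -pw => -[].
Qed.

(* Chernoff-type count: a word pair with z^(mismatches) >= c^n is given weight
   z^(mismatches) / c^n >= 1, so cylinders of level n contribute at most c^n. *)
Lemma premeasure_few_mismatches (R : realType) (K : nat) (s d z c : R) (N : nat)
    (A : set (fullshift R K * fullshift R K)) :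
  (1 < K)%N -> 0 <= s -> 0 <= z -> 0 < c < 1 -> K%:R ^- N <= d ->
  K%:R `^ (- s) * (K%:R * (K%:R * z + (1 - z))) = c ^+ 2 ->
  (forall xy, A xy -> exists2 n, (N <= n)%N &
     c ^+ n <= z ^+ #|[pred i : 'I_n | xy.1 i != xy.2 i]|) ->
  (hausdorff_premeasure s d A <= (c ^+ N / (1 - c))%:E)%E.
Proof.
move=> K1 s0 z0 /andP[c0 c1] KNd cE Afew.
pose T_ n := {ffun 'I_n -> 'I_K * 'I_K}.
pose weight n (w : T_ n) : R := \prod_i mismatch_weight z (w i).
have weight_ge0 n (w : T_ n) : 0 <= weight n w.
  by apply: prodr_ge0 => i _; exact: mismatch_weight_ge0.
(* Requiring n >= N keeps diameters at most K^-N <= d; all other words get the empty set. *)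
pose good n (w : T_ n) := (N <= n)%N && (c ^+ n <= weight n w).
pose U (t : {n : nat & T_ n}) := if good _ (tagged t)
  then pair_cylinder (R := R) (tagged t) else set0.
have K0 : 0 < K%:R :> R by rewrite ltr0n ltnW.
have d0 : 0 <= d by apply: le_trans KNd; rewrite invr_ge0 exprn_ge0.
apply: le_trans (hausdorff_premeasure_le (U := U) s d0 _ _) _.
- move=> xy /Afew[n Nn xyn].
  pose w : T_ n := [ffun i : 'I_n => (xy.1 i, xy.2 i)].
  exists (Tagged T_ w) => //; rewrite /U ifT; first by move=> i; rewrite ffunE.
  rewrite /good /= Nn /weight.
  under eq_bigr do rewrite ffunE.
  by rewrite prod_mismatch_weight.
- move=> [n w]; rewrite /U /=; case: ifPn => [/andP[/= Nn _]|_].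
    apply: (le_trans (diam_pair_cylinder R w)); rewrite lee_fin.
    apply: le_trans KNd; rewrite lef_pV2 ?posrE ?exprn_gt0//.
    by rewrite ler_weXn2l// ler1n ltnW.
  by apply: diam_le => // p q [].
rewrite esum_tagged_fin; last by move=> t; exact: diam_weight_ge0.
apply: le_trans (nneseries_geometric_tail_le N _); last by rewrite (ltW c0).
apply: lee_nneseries => [n _ _|n _].
  by apply: sume_ge0 => w _; exact: diam_weight_ge0.
(* On good words [weight n w / c ^+ n] is at least 1 and may multiply K^(-s n); words that are not
   good have weight 0 on the left. *)
have le_w (w : T_ n) : (diam_weight s (U (Tagged T_ w)) <=
    (if (N <= n)%N then (K%:R `^ (- s) / c) ^+ n * weight n w else 0)%:E)%E.
  rewrite /U /good /=; case: ifPn => [/andP[-> cw]|_]; last first.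
    rewrite /diam_weight eqxx lee_fin; case: ifP => // _.
    by rewrite mulr_ge0// exprn_ge0// divr_ge0 ?powR_ge0// ltW.
  apply: le_trans (diam_weight_le s0 _ (diam_pair_cylinder R w)) _.
    by rewrite invr_ge0 exprn_ge0.
  have Kn0 : 0 <= K%:R ^+ n :> R by rewrite exprn_ge0.
  rewrite lee_fin -(powR_inv1 Kn0) -(powR_mulrn n (ltW K0)) -!powRrM.
  rewrite [X in _ `^ X](_ : _ = - s * n%:R); last by lra.
  rewrite powRrM powR_mulrn ?powR_ge0// exprMn -mulrA ler_peMr//.
  by rewrite exprVn mulrC ler_pdivlMr ?exprn_gt0// mul1r.
apply: le_trans (lee_sum _ (fun w _ => le_w w)) _.
rewrite sumEFin lee_fin; case: ifP => _; last by rewrite sumr_const mul0rn.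
(* By [cE], level n sums to (c^2 / c)^n = c^n. *)
rewrite -mulr_sumr sum_prod_mismatch_weight -exprMn.
by rewrite mulrAC cE expr2 mulfK ?gt_eqF.
Qed.

(** * Few mismatches from proximality, and the upper bound on dimension *)

(** Distance below 1 forces equal first letters, so a frequency of close times above 1 - e leaves
    fewer than e n mismatches. *)
Lemma mismatch_frequency_lt (R : realType) (K : nat) (x y : fullshift R K)
    (e : R) (N : nat) : 0 < e -> upper_dist (shift_map R K) x y 1 = 1%E ->
  exists2 n, (N <= n)%N & #|[pred i : 'I_n | x i != y i]|%:R < e * n%:R.
Proof.
move=> e0 xy1; have : ((1 - e)%:E < upper_dist (shift_map R K) x y 1)%E.
  by rewrite xy1 lte_fin; lra.
(* Starting from [N.+1] makes n positive. *)
move=> /(limn_esup_frequently N.+1)[n Nn freq_n]; exists n; first exact: ltnW.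
have n0 : 0 < n%:R :> R by rewrite ltr0n (leq_trans _ Nn).
move: freq_n; rewrite /close_freq lte_fin ltr_pdivlMr//.
set C := #|_| => eC; set D := #|_|.
suff: D%:R + C%:R <= n%:R :> R by lra.
rewrite -natrD ler_nat -[leqRHS]card_ord -(cardC [pred i : 'I_n | x i != y i]).
rewrite leq_add2l /C; apply: subset_leq_card; apply/fintype.subsetP => i.
rewrite !inE negbK.
rewrite fullshift_mdistE -[1]invr1 -(expr0 K%:R) => /rho_lt_agree.
by rewrite !iter_shift addn0 => ->.
Qed.

(** As z tends to 0, K^(-s) K (K z + 1 - z) tends to K^(1 - s) < 1. A suitable z makes it c^2 with c
    < 1, and the premeasure is then at most c^N / (1 - c) for all large N. *)
Lemma premeasure_upper_dist1 (R : realType) (K : nat) (s d : R) :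
  (1 < K)%N -> 1 < s -> 0 < d ->
  hausdorff_premeasure s d
    [set xy : fullshift R K * fullshift R K |
      upper_dist (shift_map R K) xy.1 xy.2 1 = 1%E] = 0%E.
Proof.
move=> K1 s1 d0; have K0 : 0 < K%:R :> R by rewrite ltr0n ltnW.
have K2 : 2 <= K%:R :> R by rewrite ler_nat.
pose a : R := K%:R `^ (1 - s).
have a0 : 0 < a by rewrite powR_gt0.
have a1 : a < 1.
  rewrite /a /powR gt_eqF// expR_lt1 nmulr_rlt0 ?subr_lt0//.
  by rewrite ln_gt0// ltr1n.
(* This choice gives K z = (1 - a) / 2, hence b < a (3 - a) / 2 < 1. *)
pose z : R := (1 - a) / (2 * K%:R).
have Kz : K%:R * z = (1 - a) / 2 by rewrite /z; field; rewrite gt_eqF.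
have z0 : 0 < z by rewrite divr_gt0 ?subr_gt0 ?mulr_gt0.
have z1 : z < 1 by nra.
pose b : R := a * (K%:R * z + (1 - z)).
have b0 : 0 < b by rewrite mulr_gt0//; nra.
have b1 : b < 1 by rewrite /b Kz; nra.
pose c : R := Num.sqrt b.
have c0 : 0 < c by rewrite sqrtr_gt0.
have c1 : c < 1 by rewrite -sqrtr1 ltr_sqrt.
have cE : K%:R `^ (- s) * (K%:R * (K%:R * z + (1 - z))) = c ^+ 2.
  rewrite sqr_sqrtr ?ltW// /b /a powRD; last by rewrite (gt_eqF K0) implybT.
  by rewrite powRr1 ?ltW//; ring.
have lnz0 : ln z < 0 by rewrite ln_lt0// z0.
have lnc0 : ln c < 0 by rewrite ln_lt0// c0.
(* For eta = ln c / ln z one has z^eta = c, so fewer than eta n mismatches give a weight of at least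
   c^n. *)
have eta0 : 0 < ln c / ln z by rewrite nmulr_rgt0// invr_lt0.
apply/eqP; rewrite eq_le hausdorff_premeasure_ge0 andbT.
apply/lee_addgt0Pr => e e0; rewrite add0e.
have Kinv1 : 0 <= (K%:R^-1 : R) < 1.
  by rewrite invr_ge0 ltW// invf_lt1// ltr1n.
have ec0 : 0 < e * (1 - c) by rewrite mulr_gt0// subr_gt0.
have c01 : 0 <= c < 1 by rewrite ltW.
have [N [/ltW KNd cNe]] :=
  filter_ex (filterI (near_expr_lt Kinv1 d0) (near_expr_lt c01 ec0)).
apply: le_trans (premeasure_few_mismatches K1 _ (ltW z0) _ _ cE _ (N := N)) _.
- by lra.
- by rewrite c0.
- by rewrite -exprVn.
- move=> xy xy1; have [n Nn few] := mismatch_frequency_lt N eta0 xy1.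
  exists n => //; rewrite -{1}(lnK c0) -{1}(lnK z0) -!expRM_natl ler_expR.
  rewrite (_ : n%:R * ln c = ln c / ln z * n%:R * ln z).
    by rewrite ler_nM2r// ltW.
  by field; rewrite lt_eqF.
- by rewrite lee_fin ler_pdivrMr ?subr_gt0// ltW.
Qed.

Theorem corollary6p13 (R : realType) (K : nat) (hK : (2 <= K)%N) :
  hausdorff_dim (DC1_pairs (shift_map R K)) = 1%:E /\
  hausdorff_dim (DC2_pairs (shift_map R K)) = 1%:E.
Proof.
have DC1_graph (x : fullshift R K) := flip_odd_blocks_DC1 x hK.
(* Both relations force the upper distribution at e = 1 to be 1, and covers of that larger set also
   cover A. *)
have dim_le1 (A : set (fullshift R K * fullshift R K)) :
    (forall xy, A xy -> upper_dist (shift_map R K) xy.1 xy.2 1 = 1%E) ->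
    (hausdorff_dim A <= 1)%E.
  move=> A1; apply: hausdorff_dim_le1 => s s1 d d0; apply/eqP.
  rewrite eq_le hausdorff_premeasure_ge0 andbT.
  rewrite -(premeasure_upper_dist1 hK s1 d0).
  apply: ereal_inf_le_tmp => _ [U [AU Ud] <-]; exists U => //; split => //.
  by apply: subset_trans AU; exact: A1.
split; apply/eqP; rewrite eq_le; apply/andP; split.
- by apply: dim_le1 => xy [+ _]; exact.
- exact: hausdorff_dim_graph_ge1 DC1_graph.
- by apply: dim_le1 => xy [+ _]; exact.
- by apply: hausdorff_dim_graph_ge1 hK _ => x; apply/DC1_sub_DC2/DC1_graph.
Qed.
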